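(* Let $g=(R,\vec b)\in\mathrm{SE}(3)$, with the origin chosen on the screw axis of $g$ if $R\neq\mathrm{Id}$, and let $\iota_{\mathfrak z}:\mathfrak z(g)\hookrightarrow\mathfrak{se}(3)$ denote the inclusion of the Lie algebra of its centralizer $Z(g)$. The discrete momentum map for the $Z(g)$-action on $(\mathsf M_g,\Omega^{\mathsf{MW}})$ is $$\mu_g^{\mathrm{disc}}:\mathsf M_g\to\mathfrak z(g)^*,\qquad\gamma\mapsto\iota_{\mathfrak z}^*\begin{pmatrix}\mathsf V(\gamma)\\ \mathsf A(\gamma)\end{pmatrix},$$ i.e. for every $\xi=(\vec\omega,\vec v)\in\mathfrak z(g)$ one has $\iota_{X_\xi}\Omega^{\mathsf{MW}}=d\langle\mu_g^{\mathrm{disc}}\mid\xi\rangle$ on $\mathsf M_g$, where $X_\xi(\gamma)_i=\vec\omega\times\vec\gamma_i+\vec v$ and $\langle\mu_g^{\mathrm{disc}}(\gamma)\mid\xi\rangle=\langle\mathsf V(\gamma),\vec\omega\rangle+\langle\mathsf A(\gamma),\vec v\rangle$.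
   Context: Fix an integer $N\ge3$. An element $g=(R,\vec b)\in\mathrm{SE}(3)$ acts on $\mathbb R^3$ by $g(\vec x)=R\vec x+\vec b$. $\mathsf M_g$ is the space of maps $\gamma:\mathbb Z\to\mathbb R^3$, $i\mapsto\vec\gamma_i$, with $\vec\gamma_{i+N}=g(\vec\gamma_i)$ and $\vec\gamma_{i+1}\neq\vec\gamma_i$ for all $i\in\mathbb Z$; it is parametrized by $(\vec\gamma_1,\dots,\vec\gamma_N)$, an open subset of $(\mathbb R^3)^N$. Tangent vectors $X\in T_\gamma\mathsf M_g$ are maps $X:\mathbb Z\to\mathbb R^3$ with $X_{i+N}=R\,X_i$. $Z(g)=\{h\in\mathrm{SE}(3):hg=gh\}$ acts vertexwise on $\mathsf M_g$; its Lie algebra is $\mathfrak z(g)\subset\mathfrak{se}(3)$. $\mathfrak{se}(3)$ is identified with pairs $(\vec\omega,\vec v)\in\mathbb R^3\times\mathbb R^3$ (infinitesimal motion $\vec x\mapsto\vec\omega\times\vec x+\vec v$), and its dual with pairs $(\vec l,\vec p)$ via $\langle(\vec l,\vec p)\mid(\vec\omega,\vec v)\rangle=\langle\vec l,\vec\omega\rangle+\langle\vec p,\vec v\rangle$. If $R\ne\mathrm{Id}$, the origin is chosen on the screw axis, so that $R\vec b=\vec b$; let $\vec s_g$ be a unit vector with $R\vec s_g=\vec s_g$. If $R=\mathrm{Id},\vec b\ne0$, let $\vec s_g=\vec b/|\vec b|$. Then $\mathfrak z(g)$ is $\mathfrak{se}(3)$ if $g=\mathrm{id}$; $\{(\vec\omega,\vec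 v):\vec\omega\parallel\vec s_g\}$ if $R=\mathrm{Id},\vec b\neq0$; $\{(\vec\omega,\vec v):\vec\omega,\vec v\parallel\vec s_g\}$ if $R\ne\mathrm{Id}$. With $\vec e_i=\vec\gamma_{i+1}-\vec\gamma_i$ and $X_i(s)=(1-s)X_i+sX_{i+1}$, the discrete Marsden–Weinstein form is $\Omega^{\mathsf{MW}}_\gamma(X,Y)=\sum_{i=1}^N\int_0^1\det(X_i(s),Y_i(s),\vec e_i)\,ds$. The discrete area and volume vectors are $$\mathsf A(\gamma)=\tfrac12\sum_{i=1}^N\vec\gamma_i\times\vec\gamma_{i+1}-\tfrac12\vec b\times\vec\gamma_1,\qquad \mathsf V(\gamma)=\tfrac13\sum_{i=1}^N\tfrac{\vec\gamma_i+\vec\gamma_{i+1}}2\times(\vec\gamma_i\times\vec\gamma_{i+1})-\tfrac16\vec\gamma_1\times(\vec b\times\vec\gamma_1).$$ Momentum map of an action on a (pre-)symplectic manifold $(M,\Omega)$ with Lie algebra $\mathfrak g$: a map $\mu:M\to\mathfrak g^*$ with $\iota_{X_\xi}\Omega=d\langle\mu\mid\xi\rangle$ for every $\xi\in\mathfrak g$, where $X_\xi$ is the vector field generated by $\xi$ and $\iota_X\Omega=\Omega(X,\cdot)$. *)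

(* Defs.v *)
From mathcomp Require Import all_boot all_order all_algebra.
From mathcomp Require Import all_classical all_reals all_analysis.
Set Implicit Arguments.
Unset Strict Implicit.
Unset Printing Implicit Defensive.
Import Order.TTheory GRing.Theory Num.Theory.
Import numFieldNormedType.Exports.
Local Open Scope classical_set_scope.
Local Open Scope ring_scope.

Section SpaceCurves.
Variable R : realType.
Local Notation vec := 'cV[R]_3.

Definition dot (u v : vec) : R := \sum_k u k 0 * v k 0.

(* The indices k + 1 and k + 2 are taken in the ring 'I_3, i.e. modulo 3. *)
Definition cross (u v : vec) : vec :=
  \col_(k < 3) (u (k + 1) 0 * v (k + 2) 0 - u (k + 2) 0 * v (k + 1) 0).

Definition det3 (u v w : vec) : R :=
  \det (row_mx u (row_mx v w) : 'M[R]_3).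

(* The pair (A, b) stands for the affine map x |-> A x + b. *)
Definition affine : Type := ('M[R]_3 * 'cV[R]_3)%type.

Definition act (g : affine) (x : vec) : vec := g.1 *m x + g.2.

Definition comp (g h : affine) : affine := (g.1 *m h.1, g.1 *m h.2 + g.2).

Definition SE3 : set affine :=
  [set g | g.1 *m g.1^T = 1%:M /\ \det g.1 = 1].

Definition centralizer (g : affine) : set affine :=
  [set h | SE3 h /\ comp h g = comp g h].

(* An infinitesimal motion (w, v) stands for x |-> w * x + v (cross product);
   the same type of pairs (l, p) serves for the dual of se(3). *)
Definition se3 : Type := ('cV[R]_3 * 'cV[R]_3)%type.

Definition infmotion (xi : se3) (x : vec) : vec := cross xi.1 x + xi.2.

Definition pairing (m xi : se3) : R := dot m.1 xi.1 + dot m.2 xi.2.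

(* The Lie algebra of a closed subgroup H of SE(3): the velocities at 0 of the
   one-parameter groups t |-> exp (t xi) that lie in H.  A one-parameter group
   differentiable at 0 is of this form. *)
Definition lie_algebra (H : set affine) : set (se3) :=
  [set xi | exists h : R -> affine,
    [/\ forall t, H (h t),
        forall s t, h (s + t) = comp (h s) (h t) &
        forall x : vec,
          is_derive (0 : R) 1 (fun t : R => act (h t) x) (infmotion xi x)]].

Definition zlie (g : affine) : set (se3) := lie_algebra (centralizer g).

Definition is_linear_form (S : set se3) (f : S -> R) : Prop :=
  forall (a : R) (x y z : S),
    set_val z = (a *: (set_val x).1 + (set_val y).1,
                 a *: (set_val x).2 + (set_val y).2) ->
    f z = a * f x + f y.

(* The restriction to S of the linear form on se(3) given by m. *)
Definition iota_dual (S : set se3) (m : se3) : S -> R :=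
  fun xi => pairing m (set_val xi).

Definition vmap : Type := int -> 'cV[R]_3.

Section Monodromy.
Variables (N : nat) (g : affine).

Definition Mspace : set vmap :=
  [set c | (forall i : int, c (i + N%:Z) = act g (c i)) /\
           (forall i : int, c (i + 1) <> c i)].

Definition tangent : set vmap :=
  [set X | forall i : int, X (i + N%:Z) = g.1 *m X i].

Definition edge (c : vmap) (i : int) : vec := c (i + 1) - c i.

Definition interp (X : vmap) (i : int) (s : R) : vec :=
  (1 - s) *: X i + s *: X (i + 1).

Definition OmegaMW (c X Y : vmap) : R :=
  \sum_(1 <= i < N.+1)
    \int[lebesgue_measure]_(s in `[0, 1])
      det3 (interp X i%:Z s) (interp Y i%:Z s) (edge c i%:Z).

Definition area (c : vmap) : vec :=
  2^-1 *: (\sum_(1 <= i < N.+1) cross (c i%:Z) (c (i%:Z + 1)))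
  - 2^-1 *: cross g.2 (c 1).

Definition volume (c : vmap) : vec :=
  3^-1 *: (\sum_(1 <= i < N.+1)
     cross (2^-1 *: (c i%:Z + c (i%:Z + 1))) (cross (c i%:Z) (c (i%:Z + 1))))
  - 6^-1 *: cross (c 1) (cross g.2 (c 1)).

(* The global chart of Mspace: column k of the matrix is the vertex c_(k+1). *)
Definition coords (c : vmap) : 'M[R]_(3, N) := \matrix_(j, k) c k.+1%:Z j 0.

Definition actV (x : vec) : vec := g.1^T *m (x - g.2).

Definition actz (q : int) : vec -> vec :=
  match q with Posz n => iter n (act g) | Negz n => iter n.+1 actV end.

(* The inverse of the chart: c_(1 + r + q N) = g^q (column r), 0 <= r < N.
   The value 0 is never used when 0 < N. *)
Definition extend (p : 'M[R]_(3, N)) : vmap := fun i =>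
  actz ((i - 1) %/ N%:Z)%Z
    (oapp (fun r : 'I_N => col r p) 0 (insub `|((i - 1) %% N%:Z)%Z|%N)).

Definition differentiable_at (F : vmap -> R) (c : vmap) : Prop :=
  differentiable (F \o extend) (coords c).

(* dF_c (Y), for a function F on Mspace, read in the chart. *)
Definition differential (F : vmap -> R) (c Y : vmap) : R :=
  'd (F \o extend) (coords c) (coords Y).

Definition gen_field (xi : se3) (c : vmap) : vmap :=
  fun i => infmotion xi (c i).

(* mu is a momentum map Mspace -> zlie g ^* for the action of the centralizer
   of g by c |-> act h \o c, with respect to the two-form Om. *)
Definition is_momentum_map (Om : vmap -> vmap -> vmap -> R)
    (mu : vmap -> zlie g -> R) : Prop :=
  (forall c, Mspace c -> is_linear_form (mu c)) /\
  (forall (xi : zlie g) (c : vmap), Mspace c ->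
     differentiable_at (mu^~ xi) c /\
     forall Y : vmap, tangent Y ->
       Om c (gen_field (set_val xi) c) Y = differential (mu^~ xi) c Y).

Definition mu_disc (c : vmap) : zlie g -> R :=
  @iota_dual (zlie g) (volume c, area c).

Lemma act_actV (x : vec) : SE3 g -> act g (actV x) = x.
Proof. by case=> gg _; rewrite /act /actV mulmxA gg mul1mx subrK. Qed.

Lemma actV_act (x : vec) : SE3 g -> actV (act g x) = x.
Proof.
by case=> gg _; rewrite /act /actV addrK mulmxA (mulmx1C gg) mul1mx.
Qed.

Lemma actz_shift (c : vmap) (i q : int) : SE3 g ->
  (forall i : int, c (i + N%:Z) = act g (c i)) ->
  c (i + q * N%:Z) = actz q (c i).
Proof.
move=> gS cE; case: q => n.
  elim: n => [|n IHn]; first by rewrite mul0r addr0.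
  by rewrite intS mulrDl mul1r addrCA addrC cE IHn.
have cV j : c (j - N%:Z) = actV (c j).
  by rewrite -{2}(subrK N%:Z j) cE actV_act.
rewrite NegzE; elim: n => [|n IHn]; first by rewrite mulN1r cV.
by rewrite intS opprD mulrDl mulN1r addrCA addrC cV IHn.
Qed.

Lemma extend_coords (c : vmap) : (0 < N)%N -> SE3 g ->
  (forall i : int, c (i + N%:Z) = act g (c i)) -> extend (coords c) = c.
Proof.
move=> N0 gS cE; apply/funext => i; rewrite /extend.
have N0' : N%:Z != 0 by rewrite eqz_nat -lt0n.
have rN : (`|((i - 1) %% N%:Z)%Z|%N < N)%N.
  by rewrite -ltz_nat gez0_abs ?modz_ge0// ltz_pmod// ltz_nat.
rewrite (insubT (fun k => (k < N)%N) rN)/=.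
rewrite [RHS](_ : _ = actz ((i - 1) %/ N%:Z)%Z
    (c (1 + `|((i - 1) %% N%:Z)%Z|%N%:Z))); last first.
  rewrite -actz_shift// gez0_abs ?modz_ge0//; congr c.
  by rewrite -addrA [X in 1 + X]addrC -divz_eq addrC subrK.
by congr actz; apply/colP => j; rewrite !mxE/= intS.
Qed.

Lemma is_derive_act (f : R -> vec) (t : R) (df : vec) :
  is_derive t 1 f df -> is_derive t 1 (fun s => act g (f s)) (g.1 *m df).
Proof.
move=> [/[dup] fd /derivable_mxP fc]; rewrite derive_mx// => <-.
have cf (j : 'I_3) (k : 'I_1) : is_derive t 1 (fun s => act g (f s) j k)
    (\sum_(l < 3) g.1 j l *: 'D_1 (fun s => f s l k) t + 0).
  rewrite (_ : (fun _ => _) =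
    \sum_(l < 3) (g.1 j l \*: (fun s => f s l k)) + cst (g.2 j k)).
    apply: is_deriveD; apply: is_derive_sum => l.
    by apply: is_deriveZ; apply: derivableP.
  by apply/funext => s; rewrite /act !mxE fctE fct_sumE.
have Fd : derivable (fun s => act g (f s)) t 1.
  by apply/derivable_mxP => j k; have [] := cf j k.
split=> //; rewrite derive_mx//; apply/matrixP => j k.
have [_] := cf j k; rewrite !mxE addr0 => ->.
by apply: eq_bigr => l _; rewrite mxE.
Qed.

Lemma gen_field_tangent (xi : zlie g) (c : vmap) :
  Mspace c -> tangent (gen_field (set_val xi) c).
Proof.
move=> [cE _] i; rewrite /gen_field cE; have [h [Hh _ dh]] := set_valP xi.
have dL := dh (act g (c i)).
have dR := is_derive_act (dh (c i)).
have LR : (fun t : R => act (h t) (act g (c i))) =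
          (fun t : R => act g (act (h t) (c i))).
  apply/funext => t; have [_ [e1 e2]] := Hh t.
  by rewrite /act !mulmxDr !mulmxA e1 -!addrA e2.
by rewrite -(@derive_val _ _ _ _ _ _ _ dL) LR derive_val.
Qed.

End Monodromy.
End SpaceCurves.

Arguments mu_disc {R} N g c.
Arguments is_momentum_map {R} N g Om mu.

(* Main.v *)
From HB Require Import structures.
Require Import Defs.
From mathcomp Require Import all_boot all_order all_algebra.
From mathcomp Require Import all_classical all_reals all_analysis.
From mathcomp Require Import ring.

(** Write g = (A, b) and let xi = (w, v) lie in the Lie algebra of Z(g); x is
    the cross product.

    On one edge from a to a', with tangent values y and y', contracting the
    Marsden-Weinstein integrand with the field w x a + v does not give the
    derivative of the edge terms of the volume and area pairings, but the two
    differ by an exact difference T(a', y') - T(a, y), where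
      T(a, y) = 1/3 <y x a, w x a> + 1/2 <y x a, v>
    ([edge_form_telescope]).  Summed over one period, this leaves
    T(A a + b, A y) - T(a, y) at the vertex a = c_1, and the correction terms
    of the volume and area vectors are exactly those whose derivative cancels
    it ([edge_potential_act]).

    The cancellation requires that A fixes w, v and b and that w x b = 0.
    Velocities of the centralizer commute with g, which gives A w = w and
    w x b + v = A v.  With the origin on the screw axis b is fixed by A, so
    w x b is fixed by A; being also of the form A v - v, it is orthogonal to
    every vector fixed by A, hence to itself, and vanishes
    ([zlie_cross_axis]).

    The differential is taken in the chart of the first N vertices.  There a
    vertex c_i is an affine function of the coordinates, whose linear part is
    the same extension formula for the motion (A, 0) ([is_coord_diff_extend]);
    tangent vectors are the sequences equivariant under (A, 0).  So the
    differential follows from the Leibniz rule, with no case distinction at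
    the end of the period. *)

Set Implicit Arguments.
Unset Strict Implicit.
Unset Printing Implicit Defensive.
Import Order.TTheory GRing.Theory Num.Theory.
Import numFieldNormedType.Exports.
Local Open Scope classical_set_scope.
Local Open Scope ring_scope.

(** * Vector algebra in coordinates *)

Section VectorAlgebra.
Variable R : realType.
Implicit Types (u v w x y : 'cV[R]_3) (A : 'M[R]_3).

Lemma sum_ord3 (F : 'I_3 -> R) : \sum_k F k = F 0 + F 1 + F 2%:R.
Proof.
rewrite !big_ord_recl big_ord0 addr0 addrA.
by congr (F _ + F _ + F _); apply: val_inj.
Qed.

Lemma dotE u v : dot u v = u 0 0 * v 0 0 + u 1 0 * v 1 0 + u 2%:R 0 * v 2%:R 0.
Proof. exact: sum_ord3. Qed.

Lemma cross0E u v : cross u v 0 0 = u 1 0 * v 2%:R 0 - u 2%:R 0 * v 1 0.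
Proof. by rewrite mxE !add0r. Qed.

Lemma cross1E u v : cross u v 1 0 = u 2%:R 0 * v 0 0 - u 0 0 * v 2%:R 0.
Proof.
rewrite mxE; have -> : (1 + 1 : 'I_3) = 2%:R by [].
by have -> : (1 + 2 : 'I_3) = 0 by apply: val_inj.
Qed.

Lemma cross2E u v : cross u v 2%:R 0 = u 0 0 * v 1 0 - u 1 0 * v 0 0.
Proof.
rewrite mxE; have -> : (2%:R + 1 : 'I_3) = 0 by apply: val_inj.
by have -> : (2%:R + 2 : 'I_3) = 1 by apply: val_inj.
Qed.

Definition coordE := (cross0E, cross1E, cross2E, dotE).

Lemma col3P u v :
  u 0 0 = v 0 0 -> u 1 0 = v 1 0 -> u 2%:R 0 = v 2%:R 0 -> u = v.
Proof.
move=> e0 e1 e2; apply/colP => -[[|[|[|//]]] i].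
- by rewrite (_ : Ordinal i = 0) //; apply: val_inj.
- by rewrite (_ : Ordinal i = 1) //; apply: val_inj.
- by rewrite (_ : Ordinal i = 2%:R) //; apply: val_inj.
Qed.

Lemma dot_inj u v : (forall x, dot u x = dot v x) -> u = v.
Proof.
move=> uv; apply/colP => i.
have d w : dot w (delta_mx i 0) = w i 0.
  rewrite /dot (bigD1 i)//= mxE !eqxx mulr1 big1 ?addr0// => j ji.
  by rewrite mxE (negPf ji) mulr0.
by rewrite -[LHS]d uv d.
Qed.

Lemma dot_mulmx A u v : dot (A *m u) v = dot u (A^T *m v).
Proof.
have dm x y : dot x y = (x^T *m y) 0 0.
  by rewrite mxE; apply: eq_bigr => k _; rewrite mxE.
by rewrite !dm trmx_mul mulmxA.
Qed.

Lemma crossDr u v w : cross u (v + w) = cross u v + cross u w.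
Proof. by apply: col3P; rewrite !(coordE, mxE); ring. Qed.

Lemma det_mx33 A : \det A =
  A 0 0 * (A 1 1 * A 2%:R 2%:R - A 2%:R 1 * A 1 2%:R)
  - A 1 0 * (A 0 1 * A 2%:R 2%:R - A 2%:R 1 * A 0 2%:R)
  + A 2%:R 0 * (A 0 1 * A 1 2%:R - A 1 1 * A 0 2%:R).
Proof.
(* Naturals as indices let the shifted indices of minors compute. *)
pose f (i j : nat) := A (inord i) (inord j).
have fE i j : A i j = f i j by rewrite /f !inord_val.
rewrite (expand_det_col _ 0) sum_ord3 /cofactor !(expand_det_row _ ord0).
rewrite !big_ord_recl !big_ord0 /cofactor !det_mx11 !mxE !fE /= /bump /=.
ring.
Qed.

Lemma det3E u v w : det3 u v w = dot u (cross v w).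
Proof.
have e0 i : row_mx u (row_mx v w) i (0 : 'I_3) = u i 0.
  by rewrite mxE; case: splitP => // k _; rewrite (ord1 k).
have e1 i : row_mx u (row_mx v w) i (1 : 'I_3) = v i 0.
  rewrite mxE; case: splitP => [k|k kE]; first by rewrite (ord1 k).
  rewrite mxE; case: splitP => l lE; first by rewrite (ord1 l).
  by move: kE; rewrite lE.
have e2 i : row_mx u (row_mx v w) i (2%:R : 'I_3) = w i 0.
  rewrite mxE; case: splitP => [k|k kE]; first by rewrite (ord1 k).
  rewrite mxE; case: splitP => l lE; last by rewrite (ord1 l).
  by move: kE; rewrite lE (ord1 l).
by rewrite /det3 det_mx33 !e0 !e1 !e2 !coordE; ring.
Qed.

(** Pair both sides with a vector: this is the multiplicativity of the
    determinant, A^T being the inverse of A. *)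
Lemma cross_mulmx A u v : A *m A^T = 1%:M -> \det A = 1 ->
  cross (A *m u) (A *m v) = A *m cross u v.
Proof.
move=> AA dA; apply: dot_inj => x.
have det_cross y z t : dot (cross y z) t = det3 y z t.
  by rewrite det3E !coordE; ring.
rewrite dot_mulmx !det_cross -[in LHS](mul1mx x) -AA -mulmxA /det3.
by rewrite -!mul_mx_row det_mulmx dA mul1r.
Qed.

Lemma dotDl u v w : dot (u + v) w = dot u w + dot v w.
Proof. by rewrite !(dotE, mxE); ring. Qed.

Lemma dotZl a u w : dot (a *: u) w = a * dot u w.
Proof. by rewrite !(dotE, mxE); ring. Qed.

Lemma dotBl u v w : dot (u - v) w = dot u w - dot v w.
Proof. by rewrite !(dotE, mxE); ring. Qed.

Lemma dot_suml (I : Type) (s : seq I) (F : I -> 'cV[R]_3) w :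
  dot (\sum_(i <- s) F i) w = \sum_(i <- s) dot (F i) w.
Proof.
elim/big_rec2: _ => [|i x y _ <-]; last by rewrite dotDl.
by rewrite dotE !mxE; ring.
Qed.

Lemma dot_eq0 u : dot u u = 0 -> u = 0.
Proof.
move=> /eqP; rewrite psumr_eq0 => [|k _]; last by rewrite -expr2 sqr_ge0.
move=> /allP u0; apply/colP => k; have := u0 k (mem_index_enum _).
by rewrite mulf_eq0 orbb mxE => /eqP.
Qed.

Lemma cross_inj u v : (forall y, cross u y = cross v y) -> u = v.
Proof.
move=> uv.
have uv0 i := congr1 (fun w : 'cV[R]_3 => w i 0) (uv (delta_mx 0 0)).
have uv1 i := congr1 (fun w : 'cV[R]_3 => w i 0) (uv (delta_mx 1 0)).
apply: col3P.
- by have := uv1 2%:R; rewrite !cross2E !mxE /= !mulr1 !mulr0 !subr0.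
- by have := uv0 2%:R; rewrite !cross2E !mxE /= !mulr1 !mulr0 !sub0r
    => /oppr_inj.
- by have := uv1 0; rewrite !cross0E !mxE /= !mulr1 !mulr0 !sub0r => /oppr_inj.
Qed.

End VectorAlgebra.

(** * The Lie algebra of the centralizer *)

Section Centralizer.
Variables (R : realType) (g : affine R).
Hypothesis gS : SE3 g.

(** Differentiate at 0 the identity h_t (g x) = g (h_t x). *)
Lemma zlie_equivariant (xi : se3 R) x : zlie g xi ->
  infmotion xi (act g x) = g.1 *m infmotion xi x.
Proof.
move=> [h [Hh _ dh]].
have dL := dh (act g x); have dR := is_derive_act g (dh x).
have LR : (fun t : R => act (h t) (act g x)) =
          (fun t : R => act g (act (h t) x)).
  apply/funext => t; have [_ [e1 e2]] := Hh t.
  by rewrite /act !mulmxDr !mulmxA e1 -!addrA e2.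
by rewrite -(@derive_val _ _ _ _ _ _ _ dL) LR derive_val.
Qed.

Lemma zlie_translation (xi : se3 R) : zlie g xi ->
  cross xi.1 g.2 + xi.2 = g.1 *m xi.2.
Proof.
move=> /(zlie_equivariant 0); rewrite /infmotion /act mulmx0 add0r => ->.
by congr (_ *m _); rewrite -[RHS]add0r; congr (_ + _); apply: col3P;
  rewrite !(coordE, mxE); ring.
Qed.

(** Subtracting equivariance at the origin from equivariance at z leaves
    w x (A z) = A (w x z), and the right-hand side is (A w) x (A z). *)
Lemma zlie_rot_fixed (xi : se3 R) : zlie g xi -> g.1 *m xi.1 = xi.1.
Proof.
move=> xiZ; have [gg dg] := gS.
apply: cross_inj => y.
have /esym := zlie_equivariant (g.1^T *m y) xiZ.
rewrite /infmotion /act mulmxDr crossDr -addrA zlie_translation// => /addIr.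
by rewrite -cross_mulmx// mulmxA gg mul1mx.
Qed.

Hypothesis axis : g.1 <> 1%:M -> g.1 *m g.2 = g.2.

Lemma axis_fixed : g.1 *m g.2 = g.2.
Proof. by have [->|/axis//] := pselect (g.1 = 1%:M); rewrite mul1mx. Qed.

(** The vector w x b equals A v - v and is fixed by A, while A v - v is
    orthogonal to all vectors fixed by A; so w x b is orthogonal to itself. *)
Lemma zlie_cross_axis (xi : se3 R) : zlie g xi -> cross xi.1 g.2 = 0.
Proof.
move=> xiZ; have [gg dg] := gS; set d := cross _ _.
have dE : g.1 *m d = d by rewrite -cross_mulmx// zlie_rot_fixed// axis_fixed.
have dE' : g.1^T *m d = d by rewrite -{1}dE mulmxA (mulmx1C gg) mul1mx.
have dv : d = g.1 *m xi.2 - xi.2 by rewrite -zlie_translation// addrK.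
apply: dot_eq0; rewrite {1}dv dotBl dot_mulmx dE'; exact: subrr.
Qed.

Lemma zlie_trans_fixed (xi : se3 R) : zlie g xi -> g.1 *m xi.2 = xi.2.
Proof. by move=> xiZ; rewrite -zlie_translation// zlie_cross_axis// add0r. Qed.

End Centralizer.

(** * The integral over one edge *)

Lemma Rintegral01_quadratic (R : realType) (a b c : R) :
  \int[lebesgue_measure]_(s in `[0, 1]) (a + b * s + c * s ^+ 2) =
  a + b / 2 + c / 3.
Proof.
pose F : R -> R := fun s => a * s + b / 2 * s ^+ 2 + c / 3 * s ^+ 3.
have dF (s : R) : is_derive s 1 F (a + b * s + c * s ^+ 2).
  rewrite /F; apply: is_derive_eq.
  by rewrite /GRing.scale /=; field.
have cF : continuous F.
  move=> s.
  by apply: differentiable_continuous; apply/derivable1_diffP; have [] := dF s.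
transitivity (fine ((F 1)%:E - (F 0)%:E)%E); last first.
  by rewrite /F /=; field.
congr fine; apply: continuous_FTC2 => //.
- apply: continuous_subspaceT => s.
  by apply: differentiable_continuous; apply/derivable1_diffP.
- split => //.
  + by apply: cvg_at_right_filter; exact: cF.
  + by apply: cvg_at_left_filter; exact: cF.
- by move=> s _; rewrite derive1E derive_val.
Qed.

(** The integrand is quadratic in s: its end values are weighted by 1/3 and
    each mixed term by 1/6, the integral of s (1 - s). *)
Lemma Rintegral_interp_det3 (R : realType) (X Y : vmap R) (i : int)
    (u : 'cV[R]_3) :
  \int[lebesgue_measure]_(s in `[0, 1])
     det3 (interp X i s) (interp Y i s) u =
  3^-1 * (det3 (X i) (Y i) u + det3 (X (i + 1)) (Y (i + 1)) u)
  + 6^-1 * (det3 (X i) (Y (i + 1)) u + det3 (X (i + 1)) (Y i) u).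
Proof.
pose d00 := det3 (X i) (Y i) u; pose d11 := det3 (X (i + 1)) (Y (i + 1)) u.
pose m := det3 (X i) (Y (i + 1)) u + det3 (X (i + 1)) (Y i) u.
transitivity (\int[lebesgue_measure]_(s in `[0, 1])
   (d00 + (m - 2 * d00) * s + (d00 + d11 - m) * s ^+ 2)).
  apply: eq_Rintegral => s _.
  by rewrite /d00 /d11 /m !det3E /interp !(coordE, mxE); ring.
by rewrite Rintegral01_quadratic -/d00 -/d11 -/m; field.
Qed.

(** * Differentials in the chart *)

Section CoordinatewiseDifferential.
Variables (R : realType) (U : normedModType R) (p : U).
Implicit Types (f df h dh : U -> 'cV[R]_3).

(** Differentials of vector-valued maps are handled one coordinate at a time, so
    that the rules for real-valued functions give the Leibniz rule for the cross
    product. *)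
Definition is_coord_diff f df :=
  forall j, is_diff p (fun q => f q j 0) (fun q => df q j 0).

Lemma is_coord_diff_cst (a : 'cV[R]_3) : is_coord_diff (fun=> a) (fun=> 0).
Proof.
move=> j; apply: (is_diff_eq (is_diff_cst (a j 0) p)).
by apply/funext => q; rewrite mxE.
Qed.

Lemma is_coord_diffD f df h dh : is_coord_diff f df -> is_coord_diff h dh ->
  is_coord_diff (fun q => f q + h q) (fun q => df q + dh q).
Proof.
move=> fd hd j; have := is_diffD (fd j) (hd j).
by congr (is_diff _ _ _); apply/funext => q; rewrite mxE.
Qed.

Lemma is_coord_diffZ a f df : is_coord_diff f df ->
  is_coord_diff (fun q => a *: f q) (fun q => a *: df q).
Proof.
move=> fd j; have := is_diffZ a (fd j).
by congr (is_diff _ _ _); apply/funext => q; rewrite mxE.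
Qed.

Lemma is_coord_diffB f df h dh : is_coord_diff f df -> is_coord_diff h dh ->
  is_coord_diff (fun q => f q - h q) (fun q => df q - dh q).
Proof.
move=> fd hd j; have := is_diffB (fd j) (hd j).
by congr (is_diff _ _ _); apply/funext => q; rewrite !mxE.
Qed.

Lemma is_coord_diff_sum (I : Type) (s : seq I) (F dF : I -> U -> 'cV[R]_3) :
  (forall i, is_coord_diff (F i) (dF i)) ->
  is_coord_diff (fun q => \sum_(i <- s) F i q) (fun q => \sum_(i <- s) dF i q).
Proof.
move=> Fd; elim: s => [|i s IHs].
  have := is_coord_diff_cst 0.
  by congr (is_coord_diff _ _); apply/funext => q; rewrite big_nil.
have := is_coord_diffD (Fd i) IHs.
by congr (is_coord_diff _ _); apply/funext => q; rewrite big_cons.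
Qed.

Lemma is_coord_diff_mulmx (A : 'M[R]_3) f df : is_coord_diff f df ->
  is_coord_diff (fun q => A *m f q) (fun q => A *m df q).
Proof.
move=> fd j.
have := is_diffD (is_diffD (is_diffZ (A j 0) (fd 0)) (is_diffZ (A j 1) (fd 1)))
  (is_diffZ (A j 2%:R) (fd 2%:R)).
by congr (is_diff _ _ _); apply/funext => q; rewrite mxE sum_ord3.
Qed.

Lemma is_coord_diff_cross f df h dh :
  is_coord_diff f df -> is_coord_diff h dh ->
  is_coord_diff (fun q => cross (f q) (h q))
                (fun q => cross (df q) (h p) + cross (f p) (dh q)).
Proof.
move=> fd hd j.
have D := is_diffB (is_diffM (fd (j + 1)) (hd (j + 2)))
  (is_diffM (fd (j + 2)) (hd (j + 1))).
have <- : (fun q => f q (j + 1) 0) * (fun q => h q (j + 2) 0)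
   - (fun q => f q (j + 2) 0) * (fun q => h q (j + 1) 0)
   = (fun q => cross (f q) (h q) j 0).
  by apply/funext => q; rewrite mxE.
apply: (is_diff_eq D); apply/funext => q.
by rewrite !mxE !fctE /GRing.scale /=; ring.
Qed.

Lemma is_diff_dot f df w : is_coord_diff f df ->
  is_diff p (fun q => dot (f q) w) (fun q => dot (df q) w).
Proof.
move=> fd.
have := is_diffD (is_diffD (is_diffZ (w 0 0) (fd 0)) (is_diffZ (w 1 0) (fd 1)))
  (is_diffZ (w 2%:R 0) (fd 2%:R)).
congr (is_diff _ _ _); apply/funext => q.
  all: by rewrite dotE !fctE /GRing.scale /=; ring.
Qed.

End CoordinatewiseDifferential.

Section Extension.
Variables (R : realType) (N : nat) (g : affine R).
Let g0 : affine R := (g.1, 0).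

Lemma is_coord_diff_col (p : 'M[R]_(3, N)) r : is_coord_diff p (col r) (col r).
Proof.
move=> j; have -> : (fun q : 'M[R]_(3, N) => col r q j 0) = (fun q => q j r).
  by apply/funext => q; rewrite mxE.
apply: DiffDef; first exact: differentiable_coord.
have coord_lin : linear (fun q : 'M[R]_(3, N) => q j r).
  by move=> a q q'; rewrite !mxE.
pose coordM := GRing.isLinear.Build _ _ _ _ _ coord_lin.
pose coordL : {linear 'M[R]_(3, N) -> R} :=
  HB.pack (fun q : 'M[R]_(3, N) => q j r) coordM.
exact: (diff_lin (f := coordL) p (@coord_continuous _ _ _ j r)).
Qed.

(** Extension by g is a composition of g, its inverse and the choice of a
    column; the differential of each is the same map for the motion (A, 0). *)
Lemma is_coord_diff_extend (p : 'M[R]_(3, N)) i :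
  is_coord_diff p (fun q => extend g q i) (fun q => extend g0 q i).
Proof.
rewrite /extend.
have act_d f df : is_coord_diff p f df ->
    is_coord_diff p (fun q => act g (f q)) (fun q => act g0 (df q)).
  move=> fd.
  exact: is_coord_diffD (is_coord_diff_mulmx _ fd) (is_coord_diff_cst _ _).
have actV_d f df : is_coord_diff p f df ->
    is_coord_diff p (fun q => actV g (f q)) (fun q => actV g0 (df q)).
  move=> fd; apply: is_coord_diff_mulmx.
  exact: (is_coord_diffB fd (is_coord_diff_cst _ _)).
pose vertex (q : 'M[R]_(3, N)) :=
  oapp (fun r : 'I_N => col r q) 0 (insub `|((i - 1) %% N%:Z)%Z|%N).
have col_d : is_coord_diff p vertex vertex.
  by rewrite /vertex; case: insub => [r|];
    [exact: is_coord_diff_col|exact: is_coord_diff_cst].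
case: (_ %/ _)%Z => n.
  by elim: n => [|n IHn]; [exact: col_d|exact: act_d].
by elim: n => [|n IHn]; [exact: actV_d col_d|exact: actV_d IHn].
Qed.

Definition darea (c Y : vmap R) : 'cV[R]_3 :=
  2^-1 *: (\sum_(1 <= i < N.+1)
     (cross (Y i%:Z) (c (i%:Z + 1)) + cross (c i%:Z) (Y (i%:Z + 1))))
  - 2^-1 *: cross g.2 (Y 1).

Definition dvolume (c Y : vmap R) : 'cV[R]_3 :=
  3^-1 *: (\sum_(1 <= i < N.+1)
    (cross (2^-1 *: (Y i%:Z + Y (i%:Z + 1))) (cross (c i%:Z) (c (i%:Z + 1)))
     + cross (2^-1 *: (c i%:Z + c (i%:Z + 1)))
         (cross (Y i%:Z) (c (i%:Z + 1)) + cross (c i%:Z) (Y (i%:Z + 1)))))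
  - 6^-1 *: (cross (Y 1) (cross g.2 (c 1)) + cross (c 1) (cross g.2 (Y 1))).

Lemma is_coord_diff_area (p : 'M[R]_(3, N)) :
  is_coord_diff p (fun q => area N g (extend g q))
                  (fun q => darea (extend g p) (extend g0 q)).
Proof.
have ed := is_coord_diff_extend p.
have S := is_coord_diff_sum (index_iota 1 N.+1) (fun i : nat =>
  is_coord_diff_cross (ed i) (ed (i%:Z + 1))).
have B := is_coord_diff_cross (is_coord_diff_cst p g.2) (ed 1).
have := is_coord_diffB (is_coord_diffZ 2^-1 S) (is_coord_diffZ 2^-1 B).
congr (is_coord_diff _ _ _); apply/funext => q; congr (_ - 2^-1 *: _).
by apply: col3P; rewrite !(coordE, mxE); ring.
Qed.

Lemma is_coord_diff_volume (p : 'M[R]_(3, N)) :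
  is_coord_diff p (fun q => volume N g (extend g q))
                  (fun q => dvolume (extend g p) (extend g0 q)).
Proof.
have ed := is_coord_diff_extend p.
have S := is_coord_diff_sum (index_iota 1 N.+1) (fun i : nat =>
  is_coord_diff_cross
    (is_coord_diffZ 2^-1 (is_coord_diffD (ed i) (ed (i%:Z + 1))))
    (is_coord_diff_cross (ed i) (ed (i%:Z + 1)))).
have B := is_coord_diff_cross (ed 1)
  (is_coord_diff_cross (is_coord_diff_cst p g.2) (ed 1)).
have := is_coord_diffB (is_coord_diffZ 3^-1 S) (is_coord_diffZ 6^-1 B).
congr (is_coord_diff _ _ _); apply/funext => q; congr (_ - 6^-1 *: _).
by apply: col3P; rewrite !(coordE, mxE); ring.
Qed.

End Extension.

(** * The telescoping identity *)

Section Edge.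
Variable R : realType.
Implicit Types (xi : se3 R) (a x y u v w b : 'cV[R]_3).

(** Its form is forced by setting a' = y' = 0 in [edge_form_telescope], where
    the volume and area terms vanish. *)
Definition edge_potential xi a y : R :=
  3^-1 * dot (cross y a) (cross xi.1 a) + 2^-1 * dot (cross y a) xi.2.

(** For w = 0 this expands det (v, y + y', a' - a): the products of y with a'
    and of a with y' give the area term, and y' x a' - y x a remains.  The part
    linear in w has the same structure with one more factor a or a'. *)
Lemma edge_form_telescope xi a a' y y' :
  let x := infmotion xi a in let x' := infmotion xi a' in
  3^-1 * (det3 x y (a' - a) + det3 x' y' (a' - a))
  + 6^-1 * (det3 x y' (a' - a) + det3 x' y (a' - a)) =
  3^-1 * dot (cross (2^-1 *: (y + y')) (cross a a')
     + cross (2^-1 *: (a + a')) (cross y a' + cross a y')) xi.1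
  + 2^-1 * dot (cross y a' + cross a y') xi.2
  + (edge_potential xi a' y' - edge_potential xi a y).
Proof.
by rewrite /edge_potential /infmotion /= !det3E !(coordE, mxE); field.
Qed.

(** Invariance of dot and cross under A removes A from T(A a + b, A y), leaving
    T(a, y) plus terms linear in b; these agree with the right-hand side up to
    <w x b, y x a> / 6. *)
Lemma edge_potential_act (g : affine R) xi a y : SE3 g ->
  g.1 *m xi.1 = xi.1 -> g.1 *m xi.2 = xi.2 -> g.1 *m g.2 = g.2 ->
  cross xi.1 g.2 = 0 ->
  edge_potential xi (act g a) (g.1 *m y) - edge_potential xi a y =
  - (6^-1 * dot (cross y (cross g.2 a) + cross a (cross g.2 y)) xi.1
     + 2^-1 * dot (cross g.2 y) xi.2).
Proof.
move=> [gg dg] Aw Av Ab wb.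
have cA u v : cross (g.1 *m u) (g.1 *m v) = g.1 *m cross u v.
  exact: cross_mulmx.
have dA u v : dot (g.1 *m u) (g.1 *m v) = dot u v.
  by rewrite dot_mulmx mulmxA (mulmx1C gg) mul1mx.
have E1 : cross (g.1 *m y) (act g a) = g.1 *m cross y (a + g.2).
  by rewrite -cA mulmxDr Ab.
have E2 : cross xi.1 (act g a) = g.1 *m cross xi.1 a.
  by rewrite /act crossDr wb addr0 -cA Aw.
have dAv u : dot (g.1 *m u) xi.2 = dot u xi.2 by rewrite -{1}Av dA.
rewrite /edge_potential E1 E2 dA dAv.
have e : dot (cross xi.1 g.2) (cross y a) = 0.
  by rewrite wb dotE !mxE !mul0r !addr0.
by rewrite -[RHS]addr0 -(mulr0 6^-1) -e !(coordE, mxE); field.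
Qed.

End Edge.

Theorem theorem4p3 (R : realType) (N : nat) (hN : (3 <= N)%N)
    (g : affine R) (hg : SE3 g)
    (haxis : g.1 <> 1%:M -> g.1 *m g.2 = g.2) :
  is_momentum_map N g (OmegaMW N) (mu_disc N g).
Proof.
have N0 : (0 < N)%N by apply: leq_trans hN.
split=> [c _ a x y z zE|xi c [cE _]].
  by rewrite /mu_disc /iota_dual zE /pairing !(dotE, mxE); ring.
have extE : extend g (coords N c) = c by exact: extend_coords.
set g0 : affine R := (g.1, 0).
have hg0 : SE3 g0 by [].
have D := is_diffD
  (is_diff_dot (set_val xi).1 (is_coord_diff_volume g (coords N c)))
  (is_diff_dot (set_val xi).2 (is_coord_diff_area g (coords N c))).
split; first by case: D.
move=> Y YE.
have YE' : forall i : int, Y (i + N%:Z) = act g0 (Y i).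
  by move=> i; rewrite /act addr0 YE.
have extY : extend g0 (coords N Y) = Y by exact: extend_coords.
have -> : differential N g ((mu_disc N g)^~ xi) c Y =
    dot (dvolume N g (extend g (coords N c)) (extend g0 (coords N Y)))
      (set_val xi).1
    + dot (darea N g (extend g (coords N c)) (extend g0 (coords N Y)))
      (set_val xi).2.
  by case: D => _ /(congr1 (fun F => F (coords N Y))).
rewrite extE extY.
have [Aw Av] := (zlie_rot_fixed hg (set_valP xi),
  zlie_trans_fixed hg haxis (set_valP xi)).
have wb := zlie_cross_axis hg haxis (set_valP xi).
have Ab := axis_fixed haxis.
move: Aw Av wb; set z := set_val xi => Aw Av wb.
pose T (i : nat) := edge_potential z (c i%:Z) (Y i%:Z).
have boundary : T N.+1 - T 1%N = - (6^-1 * dot (cross (Y 1) (cross g.2 (c 1))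
    + cross (c 1) (cross g.2 (Y 1))) z.1 + 2^-1 * dot (cross g.2 (Y 1)) z.2).
  by rewrite /T intS cE YE edge_potential_act.
have S i : i.+1%:Z = i%:Z + 1 :> int by rewrite intS addrC.
rewrite /OmegaMW /dvolume /darea !dotBl !dotZl addrACA -opprD -boundary.
rewrite -(telescope_sumr T)// !dot_suml !mulr_sumr -!big_split /=.
apply: eq_bigr => i _; rewrite Rintegral_interp_det3 edge_form_telescope.
by rewrite /T S.
Qed.
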